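(* Let $h(\theta)$ be a ReLU neural network and let $\hat{x}(\theta)$ be the constructed piecewise linear policy approximation. (a) For every $\varepsilon>0$ there exists $\delta>0$ such that if $\|\hat{x}(\theta)-h(\theta)\|<\delta$ and $\hat{x}(\theta)$ is an $\varepsilon/2$-infeasible solution, then $h(\theta)$ is an $\varepsilon$-infeasible solution. (b) For every $\varepsilon>0$ there exists $\delta>0$ such that if $\|\hat{x}(\theta)-h(\theta)\|<\delta$ and $\hat{x}(\theta)$ is an $\varepsilon/2$-suboptimal solution, then $h(\theta)$ is an $\varepsilon$-suboptimal solution.
   Context: Parametric optimization problem: $\min_x f(x,\theta)$ subject to $x\in C(\theta)$, where $x\in X\subset\mathbb{R}^n$ is the decision variable, $\theta\in\Theta\subset\mathbb{R}^k$ is the parameter, $f:\mathbb{R}^n\times\mathbb{R}^k\to\mathbb{R}$ is the objective function, and $C$ is a correspondence (set-valued map) from $\mathbb{R}^k$ to subsets of $\mathbb{R}^n$. Standing assumptions: $f$ is continuous on $X\times\Theta$, $C$ is continuous on $\Theta$, and $C(\theta)$ is a non-empty compact set for each $\theta\in\Theta$. Define $f^\ast(\theta)=\min_{x\in C(\theta)}f(x,\theta)$ and $C^\ast(\theta)=\{x\in C(\theta): f(x,\theta)=f^\ast(\theta)\}$; $x^\ast(\theta)$ denotes an element of $C^\ast(\theta)$. $\|\cdot\|$ is the Euclidean norm and $\mathrm{Conv}$ the convex hull. For a non-empty set $A$ of vectors and $\varepsilon>0$, $\mathcal{B}_\varepsilon(A)=\{y:\exists x\in A,\ \|x-y\|<\varepsilon\}$,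 and $\mathcal{B}_\delta(\theta_0)=\mathcal{B}_\delta(\{\theta_0\})$. Continuity of the correspondence $C$ at $\theta_0$ means: for all $\varepsilon>0$ there is $\delta>0$ with $C(\theta)\subset\mathcal{B}_\varepsilon(C(\theta_0))$ for all $\theta\in\mathcal{B}_\delta(\theta_0)$ (upper hemicontinuity), and for all $\varepsilon>0$ there is $\delta>0$ with $C(\theta_0)\subset\mathcal{B}_\varepsilon(C(\theta))$ for all $\theta\in\mathcal{B}_\delta(\theta_0)$ (lower hemicontinuity). A vector $y(\theta)\in\mathbb{R}^n$ is an $\varepsilon$-infeasible solution if $y(\theta)\in\mathcal{B}_\varepsilon(C(\theta))$, and an $\varepsilon$-suboptimal solution if $|f(y(\theta),\theta)-f(x^\ast(\theta),\theta)|<\varepsilon$. Construction of $\hat{x}$: take training data $\{(\theta_i,x^\ast(\theta_i)): i=1,\dots,m\}$ with $\theta_i\in\Theta$ and $x^\ast(\theta_i)$ an arbitrarily chosen point of $C^\ast(\theta_i)$, and a finite collection $\mathcal{S}=\{S_1,\dots,S_d\}$ of subsets of $\{\theta_1,\dots,\theta_m\}$ such that: (i) for each $j$, $|S_j|=k+1$ and $\mathrm{Conv}(S_j)$ is a $k$-dimensional simplex; (ii) $\mathrm{Conv}(\{\theta_1,\dots,\theta_m\})=\bigcup_{j=1}^d\mathrm{Conv}(S_j)$; (iii) for every non-empty $J\subseteq\{1,\dots,d\}$, $\bigcap_{j\in J}\mathrm{Conv}(S_j)=\mathrm{Conv}(\bigcap_{j\in J}S_j)$. Write $S_j=\{\theta^j_1,\dots,\theta^j_{k+1}\}$.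 For $\theta\in\mathrm{Conv}(\{\theta_1,\dots,\theta_m\})$, let $j_\theta$ be an index with $\theta\in\mathrm{Conv}(S_{j_\theta})$, write $\theta=\sum_{l=1}^{k+1}\lambda^{j_\theta}_l\theta^{j_\theta}_l$ with $\lambda^{j_\theta}_l\ge0$, $\sum_l\lambda^{j_\theta}_l=1$, and set $\hat{x}(\theta)=\sum_{l=1}^{k+1}\lambda^{j_\theta}_l\,x^\ast(\theta^{j_\theta}_l)$. In the claim, $\theta$ denotes a point of $\mathrm{Conv}(\{\theta_1,\dots,\theta_m\})$, the domain of $\hat{x}$. A ReLU neural network of depth $L$ (with output in $\mathbb{R}^n$) is a feed-forward network $h(\theta)=h^L$ with $h^0=\theta$ and $h^l=\mathrm{ReLU}(W^lh^{l-1}+b^l)$ for $l=1,\dots,L$, where $\mathrm{ReLU}(t)=\max(t,0)$ acts componentwise, $b^l$ are bias vectors, and the weight matrices $W^l$ satisfy $\|W^l\|_\infty\le B_l$ for $l=1,\dots,L$ and $\|W^1\|\le B_1$ for given constants $B_l$.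
   Formalization: Part (b) additionally assumes that Conv({θ_1,…,θ_m}) lies in Θ and that x̂(θ) lies in X for every θ in it, and takes f to be continuous at each point of X×Θ as a function on R^n×R^k; without these (b) can fail. *)

(* Defs.v *)
(* Vectors of R^n are columns
   'cV[R]_n.  The library norm `|v| on matrices is the sup norm, hence the
   Euclidean norm below; both induce the library topology on 'cV[R]_n. *)
From HB Require Import structures.
From mathcomp Require Export all_boot all_order all_algebra finmap.
From mathcomp Require Export all_classical all_reals all_analysis.

Set Implicit Arguments.
Unset Strict Implicit.
Unset Printing Implicit Defensive.
Import Order.TTheory GRing.Theory Num.Theory.
Import numFieldNormedType.Exports.
Local Open Scope classical_set_scope.
Local Open Scope ring_scope.

Definition enorm (R : realType) (n : nat) (v : 'cV[R]_n) : R :=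
  Num.sqrt (\sum_(i < n) v i 0 ^+ 2).

Definition nbhd_set (R : realType) (n : nat) (e : R) (A : set 'cV[R]_n) :
    set 'cV[R]_n :=
  [set y | exists2 x, A x & enorm (x - y) < e].

Definition conv_hull (R : realType) (n : nat) (A : set 'cV[R]_n) :
    set 'cV[R]_n :=
  [set y | exists (m : nat) (a : 'I_m -> 'cV[R]_n) (w : 'I_m -> R),
    [/\ forall i, A (a i), forall i, 0 <= w i, \sum_(i < m) w i = 1
      & y = \sum_(i < m) w i *: a i]].

(* The balls range over the whole parameter space R^k. *)

Definition upper_hemicontinuous_at (R : realType) (n k : nat)
    (C : 'cV[R]_k -> set 'cV[R]_n) (t0 : 'cV[R]_k) : Prop :=
  forall e : R, 0 < e -> exists2 d : R, 0 < d &
    forall t, nbhd_set d [set t0] t -> C t `<=` nbhd_set e (C t0).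

Definition lower_hemicontinuous_at (R : realType) (n k : nat)
    (C : 'cV[R]_k -> set 'cV[R]_n) (t0 : 'cV[R]_k) : Prop :=
  forall e : R, 0 < e -> exists2 d : R, 0 < d &
    forall t, nbhd_set d [set t0] t -> C t0 `<=` nbhd_set e (C t).

Definition correspondence_continuous_at (R : realType) (n k : nat)
    (C : 'cV[R]_k -> set 'cV[R]_n) (t0 : 'cV[R]_k) : Prop :=
  upper_hemicontinuous_at C t0 /\ lower_hemicontinuous_at C t0.

(* The infimum is a minimum as soon as f is continuous on C t and C t is
   nonempty and compact. *)
Definition opt_value (R : realType) (n k : nat)
    (f : 'cV[R]_n * 'cV[R]_k -> R) (C : 'cV[R]_k -> set 'cV[R]_n)
    (t : 'cV[R]_k) : R :=
  inf [set f (x, t) | x in C t].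

Definition opt_set (R : realType) (n k : nat)
    (f : 'cV[R]_n * 'cV[R]_k -> R) (C : 'cV[R]_k -> set 'cV[R]_n)
    (t : 'cV[R]_k) : set 'cV[R]_n :=
  [set x | C t x /\ f (x, t) = opt_value f C t].

Definition infeasible_solution (R : realType) (n k : nat)
    (C : 'cV[R]_k -> set 'cV[R]_n) (e : R) (t : 'cV[R]_k) (y : 'cV[R]_n) :
    Prop :=
  nbhd_set e (C t) y.

Definition suboptimal_solution (R : realType) (n k : nat)
    (f : 'cV[R]_n * 'cV[R]_k -> R) (xstar : 'cV[R]_k -> 'cV[R]_n)
    (e : R) (t : 'cV[R]_k) (y : 'cV[R]_n) : Prop :=
  `|f (y, t) - f (xstar t, t)| < e.

Definition affinely_independent (R : realType) (n m : nat)
    (v : 'I_m -> 'cV[R]_n) : Prop :=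
  forall w : 'I_m -> R, \sum_(i < m) w i *: v i = 0 -> \sum_(i < m) w i = 0 ->
    forall i, w i = 0.

Definition is_simplex (R : realType) (n p : nat) (A : set 'cV[R]_n) : Prop :=
  exists2 v : 'I_p.+1 -> 'cV[R]_n,
    affinely_independent v & A = conv_hull (range v).

Record triangulation (R : realType) (k m d : nat) (th : 'I_m -> 'cV[R]_k)
    (S : 'I_d -> {fset 'cV[R]_k}) : Prop := Triangulation {
  tri_sub : forall j, [set` S j] `<=` range th;
  tri_card : forall j, #|` S j| = k.+1;
  tri_simplex : forall j, is_simplex k (conv_hull [set` S j]);
  tri_cover : conv_hull (range th) = \bigcup_j conv_hull [set` S j];
  tri_meet : forall J : set 'I_d, J !=set0 ->
    \bigcap_(j in J) conv_hull [set` S j] =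
    conv_hull (\bigcap_(j in J) [set` S j])
}.

(* [xhat] is unconstrained outside the convex hull of the training points. *)
Definition pwl_policy (R : realType) (n k m d : nat) (th : 'I_m -> 'cV[R]_k)
    (S : 'I_d -> {fset 'cV[R]_k}) (xstar xhat : 'cV[R]_k -> 'cV[R]_n) : Prop :=
  forall t, conv_hull (range th) t ->
    exists (j : 'I_d) (lam : 'cV[R]_k -> R),
      [/\ forall v, v \in S j -> 0 <= lam v,
          \sum_(v <- S j) lam v = 1,
          t = \sum_(v <- S j) lam v *: v
        & xhat t = \sum_(v <- S j) lam v *: xstar v].

(* [relu_net R k L q]: networks of depth L with input in R^k and output in
   R^q; depth 0 is the identity h^0 = theta, and each layer is added on the
   output side, so that the layer added to a network of depth L is layer
   L.+1. *)
Inductive relu_net (R : realType) (k : nat) : nat -> nat -> Type :=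
| relu_input : relu_net R k 0 k
| relu_layer (L p q : nat) (W : 'M[R]_(q, p)) (b : 'cV[R]_q)
    (N : relu_net R k L p) : relu_net R k L.+1 q.

Definition relu (R : realType) (n : nat) (v : 'cV[R]_n) : 'cV[R]_n :=
  map_mx (fun x => Num.max x 0) v.

Fixpoint relu_eval (R : realType) (k L q : nat) (N : relu_net R k L q)
    (t : 'cV[R]_k) : 'cV[R]_q :=
  match N in relu_net _ _ _ q' return 'cV[R]_q' with
  | relu_input => t
  | relu_layer _ _ _ W b N' => relu (W *m relu_eval N' t + b)
  end.

(* Operator norms induced by the sup norm (maximal absolute row sum) and by
   the Euclidean norm. *)

Definition opnorm_inf (R : realType) (q p : nat) (W : 'M[R]_(q, p)) : R :=
  \big[Num.max/0]_(i < q) \sum_(j < p) `|W i j|.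

Definition opnorm_euclid (R : realType) (q p : nat) (W : 'M[R]_(q, p)) : R :=
  sup [set enorm (W *m v) | v in [set v : 'cV[R]_p | enorm v <= 1]].

Fixpoint weights_bounded (R : realType) (k L q : nat) (B : nat -> R)
    (N : relu_net R k L q) : Prop :=
  match N with
  | relu_input => True
  | relu_layer L' _ _ W _ N' =>
      [/\ opnorm_inf W <= B L'.+1,
          (L' = 0)%N -> opnorm_euclid W <= B 1%N
        & weights_bounded B N']
  end.

(* Main.v *)
(* Part (a) is the triangle inequality with delta = e / 2.  For part (b), xhat
   does not depend on the simplex used to represent a parameter, so over each
   simplex the pairs (xhat t, t) are exactly the barycentric combinations of
   the pairs (xstar v, v), v a vertex.  They form a compact subset of
   X `*` Theta, near which f is uniformly continuous; delta is then common to
   the finitely many simplices. *)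
Require Import Defs.
From mathcomp Require Import all_boot all_order all_algebra finmap.
From mathcomp Require Import all_classical all_reals all_analysis.
From mathcomp Require Import ring lra.
Import Order.TTheory GRing.Theory Num.Theory.
Import numFieldNormedType.Exports.
Local Open Scope classical_set_scope.
Local Open Scope ring_scope.

(** * The Euclidean norm and its comparison with sup-norm balls *)

(** Lagrange's identity writes twice the gap as a double sum of squares. *)
Lemma cauchy_schwarz_sum (R : realDomainType) (n : nat) (a b : 'I_n -> R) :
  (\sum_i a i * b i) ^+ 2 <= (\sum_i a i ^+ 2) * (\sum_i b i ^+ 2).
Proof.
have lagrange : \sum_i \sum_j (a i * b j - a j * b i) ^+ 2 =
    2 * ((\sum_i a i ^+ 2) * (\sum_i b i ^+ 2) - (\sum_i a i * b i) ^+ 2).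
  set AB := (X in 2 * (X - _)); set C := (X in 2 * (AB - X)).
  have -> : 2 * (AB - C) = AB + AB - C - C by ring.
  rewrite {2}/AB mulrC /AB /C expr2 !big_distrlr /=.
  rewrite -!sumrN -!big_split /=; apply: eq_bigr => i _.
  rewrite -!sumrN -!big_split /=; apply: eq_bigr => j _.
  ring.
rewrite -subr_ge0 -(@pmulr_rge0 _ 2) // -lagrange.
by apply: sumr_ge0 => i _; apply: sumr_ge0 => j _; exact: sqr_ge0.
Qed.

(** After squaring both sides, the cross term is bounded by Cauchy-Schwarz. *)
Lemma enorm_triangle (R : realType) (n : nat) (u v : 'cV[R]_n) :
  enorm (u + v) <= enorm u + enorm v.
Proof.
have sum_ge0 (w : 'cV[R]_n) : 0 <= \sum_(i < n) w i 0 ^+ 2.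
  by apply: sumr_ge0 => i _; exact: sqr_ge0.
rewrite -(@ler_pXn2r _ 2) ?nnegrE ?addr_ge0 ?sqrtr_ge0 //.
rewrite sqrrD !sqr_sqrtr ?sum_ge0 // -sqrtrM ?sum_ge0 //.
have cs : \sum_i u i 0 * v i 0 <=
    Num.sqrt ((\sum_i u i 0 ^+ 2) * (\sum_i v i 0 ^+ 2)).
  apply: le_trans (ler_norm _) _.
  by rewrite -sqrtr_sqr ler_wsqrtr // cauchy_schwarz_sum.
have -> : \sum_i (u + v) i 0 ^+ 2 =
    \sum_i u i 0 ^+ 2 + (\sum_i u i 0 * v i 0) *+ 2 + \sum_i v i 0 ^+ 2.
  by rewrite -sumrMnl -!big_split /=; apply: eq_bigr => i _; rewrite mxE sqrrD.
by rewrite lerD2r lerD2l lerMn2r cs orbT.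
Qed.

Lemma norm_coord_le_enorm (R : realType) (n : nat) (v : 'cV[R]_n) i :
  `|v i 0| <= enorm v.
Proof.
rewrite -sqrtr_sqr ler_wsqrtr // (bigD1 i) //= lerDl.
by apply: sumr_ge0 => j _; exact: sqr_ge0.
Qed.

Lemma enorm_ball (R : realType) (n : nat) (u v : 'cV[R]_n) (e : R) :
  enorm (u - v) < e -> ball u e v.
Proof.
(* Matrix balls carry the positivity of their radius as a separate conjunct. *)
move=> uve; split=> [|i j]; first exact: le_lt_trans (sqrtr_ge0 _) uve.
rewrite ord1 -ball_normE /=.
apply: le_lt_trans uve.
by have := norm_coord_le_enorm _ _ (u - v) i; rewrite !mxE.
Qed.

(** * Uniform continuity around a compact set *)

(** A Heine-Cantor argument by near coverings. The point [y] may leave [K], as network outputs do;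
    the [near] form lets finitely many compact sets share one radius. *)
Lemma continuous_near_compact (R : realType) (T : pseudoMetricType R)
    (f : T -> R) (K : set T) : compact K ->
  (forall x, K x -> {for x, continuous f}) ->
  forall e : R, 0 < e -> \forall d \near 0^'+,
    forall x, K x -> forall y, ball x d y -> `|f x - f y| < e.
Proof.
move=> /compact_near_coveringP cK fK e e0.
apply: (cK R (0^'+) (fun d x => forall y, ball x d y -> `|f x - f y| < e)).
move=> x Kx.
have /cvgrPdist_lt /(_ (e / 2)) := fK x Kx.
rewrite divr_gt0 // => /(_ isT) /nbhs_ballP[r /= r0 fr].
(* If [z] is within [r / 2] of [x] and [y] within [d < r / 2] of [z], both lie in the ball of radius
   [r], where [f] stays within [e / 2] of [f x]. *)
exists (ball x (r / 2), [set d | 0 < d < r / 2]); first split => /=.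
- by apply: nbhsx_ballx; rewrite divr_gt0.
- near=> d; apply/andP; split; near: d; first exact: nbhs_right_gt.
  by apply: nbhs_right_lt; rewrite divr_gt0.
move=> [z d] /= [xz /andP[d0 dr]] y zy.
have xy : ball x r y.
  by apply: ball_split xz _; apply: le_ball zy; rewrite ltW.
have {}xz : ball x r z by apply: le_ball xz; lra.
have := fr _ xy; have := fr _ xz => fz fy.
rewrite [e](splitr e) (le_lt_trans (ler_distD (f x) _ _)) //.
by rewrite ltrD // distrC.
Unshelve. all: by end_near.
Qed.

(** * Barycentric coordinates over a finite set of vertices *)

(** The weight [lam v] collects the weights of all indices sent to [v]. One [lam] serves every [W]
    and [F], so total weight and point are regrouped by the same coefficients. *)
Lemma regroup_weights (R : realType) (k m : nat) (A : {fset 'cV[R]_k})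
    (a : 'I_m -> 'cV[R]_k) (w : 'I_m -> R) :
  (forall i, a i \in A) -> (forall i, 0 <= w i) ->
  exists lam : 'cV[R]_k -> R, (forall v, 0 <= lam v) /\
    forall (W : lmodType R) (F : 'cV[R]_k -> W),
      \sum_i w i *: F (a i) = \sum_(v <- A) lam v *: F v.
Proof.
move=> aA w0; exists (fun v => \sum_(i | a i == v) w i); split=> [v|W F].
  by apply: sumr_ge0.
under [RHS]eq_bigr do rewrite scaler_suml.
rewrite (exchange_big_dep xpredT) //=; apply: eq_bigr => i _.
rewrite (eq_bigl (pred1 (a i))) => [|v]; last by rewrite eq_sym.
by rewrite -big_filter filter_pred1_uniq ?fset_uniq // big_seq1.
Qed.

Lemma conv_hull_fset (R : realType) (k : nat) (A : {fset 'cV[R]_k}) y :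
  conv_hull [set` A] y <-> exists lam : 'cV[R]_k -> R,
    [/\ forall v, v \in A -> 0 <= lam v, \sum_(v <- A) lam v = 1
      & y = \sum_(v <- A) lam v *: v].
Proof.
split=> [[m [a [w [aA w0 w1 ->]]]]|[lam [lam0 lam1 ->]]].
  have [lam [lam0 E]] := regroup_weights _ _ _ A a w aA w0.
  exists lam; split; [by []| |exact: (E _ id)].
  (* The constant function 1 turns the regrouping identity into equality of total weights. *)
  rewrite -w1; have := E R^o (fun=> 1).
  under eq_bigr do rewrite [_ *: _]mulr1.
  by under [RHS]eq_bigr do rewrite [_ *: _]mulr1.
exists (size A), (fun i => nth 0 A i), (fun i => lam (nth 0 A i)).
split.
- by move=> i; exact: mem_nth.
- by move=> i; apply: lam0; exact: mem_nth.
- by rewrite -lam1 [RHS](big_nth 0) big_mkord.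
- by rewrite (big_nth 0) big_mkord.
Qed.

(* The barycentric coordinates of the vertices of the given simplex with
   respect to [A] form an invertible matrix, which transports affine
   independence to [A]. *)
Lemma simplex_affinely_independent (R : realType) (k p : nat)
    (A : {fset 'cV[R]_k}) : #|` A| = p.+1 -> is_simplex p (conv_hull [set` A]) ->
  forall w : 'cV[R]_k -> R,
    \sum_(v <- A) w v *: v = 0 -> \sum_(v <- A) w v = 0 ->
    forall v, v \in A -> w v = 0.
Proof.
move=> cA [v vind Av] w wv w1.
pose s (j : 'I_p.+1) := nth 0 A j.
have sumE (W : lmodType R) (F : 'cV[R]_k -> W) :
    \sum_(x <- A) F x = \sum_j F (s j).
  by rewrite (big_nth 0) big_mkord cA.
have /choice[c cP] i : exists lam : 'cV[R]_k -> R,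
    \sum_j lam (s j) = 1 /\ v i = \sum_j lam (s j) *: s j.
  have : conv_hull [set` A] (v i).
    rewrite Av; exists 1%N, (fun=> v i), (fun=> 1).
    by split=> //; rewrite big_ord1 ?scale1r.
  move=> /conv_hull_fset[lam [_ l1 l2]]; exists lam.
  by rewrite -(sumE _ (fun x => lam x *: x)) -(sumE R^o lam).
(* Row [i] holds the coordinates of [v i] and sums to 1, so [u *m B] turns weights on the [v i] into
   weights on the [s j] with the same total and the same combination. *)
pose B : 'M[R]_p.+1 := \matrix_(i, j) c i (s j).
have uB1 (u : 'rV_p.+1) : \sum_i u 0 i = \sum_j (u *m B) 0 j.
  under [RHS]eq_bigr do rewrite mxE.
  rewrite exchange_big /=; apply: eq_bigr => i _.
  rewrite -mulr_sumr; under eq_bigr do rewrite mxE.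
  by rewrite (cP i).1 mulr1.
have uBv (u : 'rV_p.+1) :
    \sum_i u 0 i *: v i = \sum_j (u *m B) 0 j *: s j.
  under [RHS]eq_bigr do rewrite mxE scaler_suml.
  rewrite exchange_big /=; apply: eq_bigr => i _.
  rewrite (cP i).2 scaler_sumr; apply: eq_bigr => j _.
  by rewrite scalerA mxE.
have uB0 (u : 'rV_p.+1) : \sum_j (u *m B) 0 j *: s j = 0 ->
    \sum_j (u *m B) 0 j = 0 -> u = 0.
  rewrite -uBv -uB1 => h1 h2; apply/rowP => i.
  by rewrite mxE (vind (u 0)).
have Bu : B \in unitmx.
  rewrite -row_free_unit; apply: inj_row_free => u uB.
  by apply: uB0; rewrite uB; apply: big1 => j _; rewrite mxE ?scale0r.
pose wr : 'rV[R]_p.+1 := \row_j w (s j).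
have wr0 : wr = 0.
  (* The row [wr *m invmx B] is an affine relation among the [v i], hence zero. *)
  rewrite -(mulmxKV Bu wr) (uB0 (wr *m invmx B)) ?mul0mx // mulmxKV //.
    rewrite -[RHS]wv (sumE _ (fun x => w x *: x)).
    by apply: eq_bigr => j _; rewrite mxE.
  by rewrite -[RHS]w1 (sumE R^o w); apply: eq_bigr => j _; rewrite mxE.
move=> x xA; have xs : (index x A < p.+1)%N by rewrite -cA index_mem.
have := congr1 (fun r : 'rV_p.+1 => r 0 (Ordinal xs)) wr0.
by rewrite !mxE /s /= nth_index.
Qed.

(** * Compactness of sets of barycentric combinations *)

Lemma continuous_lincomb (R : realType) (W : normedModType R) (n : nat)
    (c : 'I_n -> W) : continuous (fun l : 'rV[R]_n => \sum_i l 0 i *: c i).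
Proof.
apply: continuous_big => [|i _]; first exact: add_continuous.
move=> l.
by apply: (@cvgZr_tmp R W _ (nbhs l)); exact: coord_continuous.
Qed.

(** Nonnegative coordinates of sum 1 are at most 1, so the simplex is a closed part of a compact
    cube. *)
Lemma compact_std_simplex (R : realType) (n : nat) :
  compact [set l : 'rV[R]_n | (forall i, 0 <= l 0 i) /\ \sum_i l 0 i = 1].
Proof.
have -> : [set l : 'rV[R]_n | (forall i, 0 <= l 0 i) /\ \sum_i l 0 i = 1] =
    [set l : 'rV[R]_n | forall i, `[0, 1]%classic (l ord0 i)] `&`
    (fun l : 'rV[R]_n => \sum_i l 0 i *: (1 : R^o)) @^-1` [set 1].
  apply/seteqP; split=> l /= [l0 l1]; last first.
    split=> [i|]; first by have := l0 i; rewrite in_itv => /andP[].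
    by rewrite -l1; apply: eq_bigr => i _; rewrite [RHS]mulr1.
  split=> [i|]; last first.
    by rewrite -[RHS]l1; apply: eq_bigr => i _; rewrite [LHS]mulr1.
  rewrite in_itv /= l0 -l1 (bigD1 i) //= lerDl.
  by apply: sumr_ge0.
apply: compact_closedI.
  apply: (@rV_compact R n (fun=> `[0, 1]%classic)) => _.
  exact: segment_compact.
apply: closed_comp => [l _|]; first exact: (@continuous_lincomb R R^o).
exact: closed_eq.
Qed.

(** Only the weights vary, [F] entering through its values at finitely many vertices: the set is a
    continuous image of the standard simplex. *)
Lemma compact_barycenters (R : realType) (k : nat) (W : normedModType R)
    (A : {fset 'cV[R]_k}) (F : 'cV[R]_k -> W) :
  compact [set y | exists lam : 'cV[R]_k -> R,
    [/\ forall v, v \in A -> 0 <= lam v, \sum_(v <- A) lam v = 1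
      & y = \sum_(v <- A) lam v *: F v]].
Proof.
set K := (X in compact X).
pose a (i : 'I_(size A)) := nth 0 A i.
have aA i : a i \in A by exact: mem_nth.
have -> : K = [set \sum_i l 0 i *: F (a i) | l in
    [set l : 'rV[R]_(size A) | (forall i, 0 <= l 0 i) /\ \sum_i l 0 i = 1]].
  apply/seteqP; split=> [y [lam [lam0 lam1 ->]]|_ [l [l0 l1] <-]].
    exists (\row_i lam (a i)); [split=> [i|]|].
    - by rewrite mxE; apply: lam0.
    - rewrite -lam1 [RHS](big_nth 0) big_mkord.
      by apply: eq_bigr => i _; rewrite mxE.
    - rewrite [RHS](big_nth 0) big_mkord.
      by apply: eq_bigr => i _; rewrite mxE.
  have [lam [lam0 E]] := regroup_weights _ _ _ A a (l 0) aA l0.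
  exists lam; split; [by []| |exact: E].
  rewrite -l1; have := E R^o (fun=> 1).
  under eq_bigr do rewrite [_ *: _]mulr1.
  by under [RHS]eq_bigr do rewrite [_ *: _]mulr1.
apply: continuous_compact; last exact: compact_std_simplex.
by apply: continuous_subspaceT; exact: continuous_lincomb.
Qed.

(* By [tri_meet] the point has barycentric coordinates supported on the common
   vertices; by affine independence they are its coordinates in both
   simplices. *)
Lemma triangulation_barycenter_unique (R : realType) (k m d : nat)
    (th : 'I_m -> 'cV[R]_k) (S : 'I_d -> {fset 'cV[R]_k})
    (S_tri : triangulation th S) (W : lmodType R) (F : 'cV[R]_k -> W)
    (j1 j2 : 'I_d) (lam1 lam2 : 'cV[R]_k -> R) :
  (forall v, v \in S j1 -> 0 <= lam1 v) -> \sum_(v <- S j1) lam1 v = 1 ->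
  (forall v, v \in S j2 -> 0 <= lam2 v) -> \sum_(v <- S j2) lam2 v = 1 ->
  \sum_(v <- S j1) lam1 v *: v = \sum_(v <- S j2) lam2 v *: v ->
  \sum_(v <- S j1) lam1 v *: F v = \sum_(v <- S j2) lam2 v *: F v.
Proof.
move=> l1ge0 l1sum l2ge0 l2sum l12.
set t := \sum_(v <- S j1) lam1 v *: v in l12.
set I := (S j1 `&` S j2)%fset.
have : conv_hull [set` I] t.
  have -> : [set` I] = \bigcap_(j in [set j1; j2]) [set` S j].
    rewrite bigcap_setU !bigcap_set1; apply/seteqP.
    by split=> x /=; rewrite in_fsetI => /andP.
  rewrite -(tri_meet S_tri); last by exists j1; left.
  move=> _ [|] ->; apply/conv_hull_fset; first by exists lam1.
  by exists lam2; rewrite l12.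
move=> /conv_hull_fset[nu [nu0 nu1 tnu]].
have key j lam : (I `<=` S j)%fset -> \sum_(v <- S j) lam v = 1 ->
    \sum_(v <- S j) lam v *: v = t ->
    \sum_(v <- S j) lam v *: F v = \sum_(v <- I) nu v *: F v.
  move=> IS lsum lt.
  (* Extending [nu] by zero represents [t] over all of [S j] with total 1, so [lam - mu] is an
     affine relation among the vertices of [S j]. *)
  pose mu v := if v \in I then nu v else 0.
  have sumE (V : lmodType R) (G : 'cV[R]_k -> V) :
      \sum_(v <- I) nu v *: G v = \sum_(v <- S j) mu v *: G v.
    rewrite -(big_fset_incl _ IS) => [|v _ /negbTE vI].
      by apply: eq_big_seq => v vI; rewrite /mu vI.
    by rewrite /mu vI scale0r.
  have sum1 : \sum_(v <- I) nu v = \sum_(v <- S j) mu v.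
    rewrite -(big_fset_incl _ IS) => [|v _ /negbTE vI].
      by apply: eq_big_seq => v vI; rewrite /mu vI.
    by rewrite /mu vI.
  have lmu v : v \in S j -> lam v - mu v = 0.
    move: v.
    apply: (simplex_affinely_independent _ _ k _ _ (tri_simplex S_tri j)).
    - exact: (tri_card S_tri).
    - under eq_bigr do rewrite scalerBl.
      by rewrite sumrB -(sumE _ id) -tnu lt subrr.
    - by rewrite sumrB -sum1 lsum nu1 subrr.
  rewrite sumE; apply: eq_big_seq => v vS.
  by rewrite -[in LHS](subrK (mu v) (lam v)) lmu // add0r.
rewrite (key j1) ?fsubsetIl // (key j2) ?fsubsetIr //.
Qed.

(** * Transfer of infeasibility and suboptimality bounds to the network *)

Theorem theorem4p1 (R : realType) (n k : nat)
    (X : set 'cV[R]_n) (Theta : set 'cV[R]_k)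
    (f : 'cV[R]_n * 'cV[R]_k -> R) (C : 'cV[R]_k -> set 'cV[R]_n)
    (f_cont : {in X `*` Theta, continuous f})
    (C_sub : forall t, Theta t -> C t `<=` X)
    (C_cont : forall t, Theta t -> correspondence_continuous_at C t)
    (C_neq0 : forall t, Theta t -> C t !=set0)
    (C_compact : forall t, Theta t -> compact (C t))
    (xstar : 'cV[R]_k -> 'cV[R]_n)
    (xstarP : forall t, Theta t -> opt_set f C t (xstar t))
    (m d : nat) (th : 'I_m -> 'cV[R]_k) (S : 'I_d -> {fset 'cV[R]_k})
    (th_Theta : forall i, Theta (th i))
    (S_tri : triangulation th S)
    (xhat : 'cV[R]_k -> 'cV[R]_n)
    (xhatP : pwl_policy th S xstar xhat)
    (L : nat) (L_gt0 : (0 < L)%N) (B : nat -> R)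
    (N : relu_net R k L n) (N_bounded : weights_bounded B N) :
  (forall e : R, 0 < e -> exists2 delta : R, 0 < delta &
     forall t, conv_hull (range th) t ->
       enorm (xhat t - relu_eval N t) < delta ->
       infeasible_solution C (e / 2) t (xhat t) ->
       infeasible_solution C e t (relu_eval N t))
  /\
  (conv_hull (range th) `<=` Theta ->
   (forall t, conv_hull (range th) t -> X (xhat t)) ->
   forall e : R, 0 < e -> exists2 delta : R, 0 < delta &
     forall t, conv_hull (range th) t ->
       enorm (xhat t - relu_eval N t) < delta ->
       suboptimal_solution f xstar (e / 2) t (xhat t) ->
       suboptimal_solution f xstar e t (relu_eval N t)).
Proof.
split=> [e e0|hull_Theta hull_X e e0].
  exists (e / 2); first by rewrite divr_gt0.
  move=> t _ xh [x Cx xe]; exists x => //.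
  have -> : x - relu_eval N t = (x - xhat t) + (xhat t - relu_eval N t).
    by rewrite addrA subrK.
  by rewrite (le_lt_trans (enorm_triangle _ _ _ _)) // [e]splitr ltrD.
(* Values in the product let one barycentric combination carry decision and parameter together. *)
pose F v := (xstar v, v).
pose K j := [set y | exists lam : 'cV[R]_k -> R,
    [/\ forall v, v \in S j -> 0 <= lam v, \sum_(v <- S j) lam v = 1
      & y = \sum_(v <- S j) lam v *: F v]].
have KE j lam : \sum_(v <- S j) lam v *: F v =
    (\sum_(v <- S j) lam v *: xstar v, \sum_(v <- S j) lam v *: v).
  by elim: (enum_fset (S j)) => [|v s IH]; rewrite ?big_nil // !big_cons IH.
have KXT j p : K j p -> (X `*` Theta) p.
  move=> [lam [lam0 lam1 ->]]; rewrite KE.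
  set t := \sum_(v <- S j) lam v *: v.
  have ht : conv_hull (range th) t.
    rewrite (tri_cover S_tri); exists j => //.
    by apply/conv_hull_fset; exists lam.
  split=> /=; last exact: hull_Theta.
  (* The policy may represent [t] in another simplex [j']; uniqueness still identifies the first
     component with [xhat t], which lies in [X]. *)
  have [j' [mu [mu0 mu1 tmu xt]]] := xhatP t ht.
  rewrite (triangulation_barycenter_unique _ _ _ _ _ _ S_tri _ xstar
    j j' lam mu) //.
  by rewrite -xt; exact: hull_X.
have e20 : 0 < e / 2 by rewrite divr_gt0.
have unif : \forall r \near 0^'+, forall j p, K j p ->
    forall q, ball p r q -> `|f p - f q| < e / 2.
  (* Finitely many simplices, hence a common radius. *)
  apply: filter_forall => j; apply: continuous_near_compact => //.
    exact: compact_barycenters.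
  by move=> p Kp; apply: f_cont; rewrite inE; exact: KXT Kp.
have [r [r0 rK]] := filter_ex (filterI (nbhs_right_gt (0 : R)) unif).
exists r => // t ht xh sub.
have [j [lam [lam0 lam1 tE xE]]] := xhatP t ht.
have Kt : K j (xhat t, t) by exists lam; rewrite KE -tE -xE.
(* The parameter is unchanged, so the product ball only asks for closeness of the decisions. *)
have := rK j _ Kt (relu_eval N t, t).
rewrite distrC => /(_ (conj (enorm_ball _ _ _ _ _ xh) (ballxx _ r0))) fh.
by rewrite /suboptimal_solution (le_lt_trans (ler_distD (f (xhat t, t)) _ _)) //
  [e]splitr ltrD.
Qed.
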